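(* Every acyclic digraph $Q$ with at most three vertices is of finite type, i.e., its Hecke-Kiselman monoid $H_Q$ is finite.
   Context: A digraph $Q$ is a graph with at most one connection (side) between each pair of distinct vertices and no loops; each side is either an oriented arrow $i\to j$ or a non-oriented edge. The Hecke-Kiselman monoid $H_Q$ is the monoid generated by elements $a_i$, one for each vertex $i$ of $Q$, subject to the relations: $a_i^2=a_i$ for all $i$; $a_ia_j=a_ja_i$ if $i,j$ are not connected; $a_ia_ja_i=a_ja_ia_j$ if $i,j$ are connected by an edge; $a_ia_j=a_ia_ja_i=a_ja_ia_j$ if there is an arrow from $i$ to $j$. The digraph $Q$ is of finite type if $H_Q$ is finite. A cycle in $Q$ is a sequence $(v_i)_{i\in\mathbb{Z}/n\mathbb{Z}}$, $n\ge 3$, of pairwise distinct vertices such that for each $i\in\mathbb{Z}/n\mathbb{Z}$ there is in $Q$ either an edge between $v_i$ and $v_{i+1}$ or an arrow from $v_i$ to $v_{i+1}$. $Q$ is acyclic if it contains no cycles. *)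

(* Defs.v *)
From HB Require Import structures.
From mathcomp Require Import all_boot all_algebra generic_quotient.
From mathcomp Require Import boolp classical_sets functions cardinality.

Set Implicit Arguments.
Unset Strict Implicit.
Unset Printing Implicit Defensive.

Section Presentation.

Variables (A : choiceType) (r : seq A -> seq A -> Prop).

(* Least congruence on the free monoid [seq A] containing [r]. *)
Inductive congruence_closure : seq A -> seq A -> Prop :=
| cc_refl w : congruence_closure w w
| cc_sym w w' : congruence_closure w w' -> congruence_closure w' w
| cc_trans w1 w2 w3 :
    congruence_closure w1 w2 -> congruence_closure w2 w3 ->
    congruence_closure w1 w3
| cc_rel u v x y : r x y -> congruence_closure (u ++ x ++ v) (u ++ y ++ v).

Definition congruence_rel : rel (seq A) :=
  fun x y => `[< congruence_closure x y >].

Lemma congruence_rel_equiv : equiv_class_of congruence_rel.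
Proof.
split=> [x|x y|y x z].
- by apply/asboolP; exact: cc_refl.
- by apply/asboolP/asboolP => /cc_sym.
- by move=> /asboolP xy /asboolP yz; apply/asboolP; exact: cc_trans xy yz.
Qed.

Canonical congruence_equiv := EquivRelPack congruence_rel_equiv.

Definition presented_monoid : Type := {eq_quot congruence_equiv}%qT.

HB.instance Definition _ := Choice.on presented_monoid.
HB.instance Definition _ := EqQuotient.on presented_monoid.

Definition presented_pi (w : seq A) : presented_monoid := \pi_presented_monoid%qT w.

Lemma presented_piP (x y : seq A) :
  presented_pi x = presented_pi y <-> congruence_closure x y.
Proof. by split=> [/eqmodP/asboolP|xy] //; apply/eqmodP/asboolP. Qed.

Lemma congruence_closure_cat (x x' y y' : seq A) :
  congruence_closure x x' -> congruence_closure y y' ->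
  congruence_closure (x ++ y) (x' ++ y').
Proof.
have catl z u v : congruence_closure u v -> congruence_closure (z ++ u) (z ++ v).
  elim=> {u v} [w|w w' _|w1 w2 w3 _ IH1 _|u v a b rab].
  - exact: cc_refl.
  - exact: cc_sym.
  - exact: cc_trans.
  - by rewrite catA (catA z u (b ++ v)); exact: cc_rel.
have catr z u v : congruence_closure u v -> congruence_closure (u ++ z) (v ++ z).
  elim=> {u v} [w|w w' _|w1 w2 w3 _ IH1 _|u v a b rab].
  - exact: cc_refl.
  - exact: cc_sym.
  - exact: cc_trans.
  - by rewrite -!catA; exact: cc_rel.
by move=> xx' yy'; apply: cc_trans (catr y _ _ xx') (catl x' _ _ yy').
Qed.

Definition presented_one : presented_monoid := presented_pi [::].
Definition presented_mul (a b : presented_monoid) : presented_monoid :=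
  presented_pi (repr a ++ repr b).

Lemma presented_mul_pi (x y : seq A) :
  presented_mul (presented_pi x) (presented_pi y) = presented_pi (x ++ y).
Proof.
by apply/presented_piP/congruence_closure_cat; apply/presented_piP;
  rewrite /presented_pi reprK.
Qed.

Lemma presented_pi_repr (a : presented_monoid) : presented_pi (repr a) = a.
Proof. exact: reprK. Qed.

Lemma presented_mulA : associative presented_mul.
Proof.
move=> a b c; rewrite -(presented_pi_repr a) -(presented_pi_repr b).
by rewrite -(presented_pi_repr c) !presented_mul_pi catA.
Qed.

Lemma presented_mul1 : left_id presented_one presented_mul.
Proof. by move=> a; rewrite -(presented_pi_repr a) presented_mul_pi. Qed.

Lemma presented_mulr1 : right_id presented_one presented_mul.
Proof. by move=> a; rewrite -(presented_pi_repr a) presented_mul_pi cats0. Qed.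

HB.instance Definition _ := isMonoid.Build presented_monoid
  presented_mulA presented_mul1 presented_mulr1.

End Presentation.

(* [edge i j] is a non-oriented side, stored in both directions; the last two
   axioms say that a pair of vertices carries at most one side. *)
Record digraph (V : finType) := Digraph {
  arrow : rel V;
  edge : rel V;
  arrow_irr : irreflexive arrow;
  edge_irr : irreflexive edge;
  edge_sym : symmetric edge;
  arrow_asym : forall i j, arrow i j -> ~~ arrow j i;
  arrow_not_edge : forall i j, arrow i j -> ~~ edge i j
}.

Section HeckeKiselman.

Variables (V : finType) (Q : digraph V).

Definition connected (i j : V) : bool :=
  [|| edge Q i j, arrow Q i j | arrow Q j i].

(* The word [:: i1; ...; ik] stands for the product a_i1 * ... * a_ik. *)
Inductive hk_rel : seq V -> seq V -> Prop :=
| hk_idem i : hk_rel [:: i; i] [:: i]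
| hk_comm i j : ~~ connected i j -> hk_rel [:: i; j] [:: j; i]
| hk_braid i j : edge Q i j -> hk_rel [:: i; j; i] [:: j; i; j]
| hk_arrow1 i j : arrow Q i j -> hk_rel [:: i; j] [:: i; j; i]
| hk_arrow2 i j : arrow Q i j -> hk_rel [:: i; j; i] [:: j; i; j].

Definition hecke_kiselman : monoidType := presented_monoid hk_rel.

Definition finite_type : Prop := finite_set [set: hecke_kiselman].

(* ['Z_n] is the ring of integers mod n only for n > 1, ensured by [2 < n]. *)
Definition is_cycle (n : nat) (v : 'Z_n -> V) : Prop :=
  [/\ 2 < n, injective v
    & forall i : 'Z_n,
        edge Q (v i) (v (i + 1)%R) || arrow Q (v i) (v (i + 1)%R)].

Definition acyclic : Prop := forall (n : nat) (v : 'Z_n -> V), ~ is_cycle v.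

End HeckeKiselman.

(* Main.v *)
Require Import Defs.
From mathcomp Require Import zmodp classical_sets cardinality.
From mathcomp Require Import all_boot.

(** A vertex [c] all of whose sides are arrows pointing away from it satisfies
    [c w c = c w] for every word [w], and dually [c w c = w c] if they all point
    towards it; so deleting such a source or sink [c] reduces finiteness to the
    remaining vertices, every element being [u] or [u c v] with [u], [v] free of
    [c]. An acyclic digraph on three vertices without source or sink is a path
    with two non-oriented edges, whose monoid is the 0-Hecke monoid of type A_3:
    every element is [u s] with [u] a word in [x], [y] and [s] among
    [1, z, zy, zyx], as in the Coxeter group. *)

Set Implicit Arguments.
Unset Strict Implicit.
Unset Printing Implicit Defensive.

Section Words.

Variables (V : finType) (Q : digraph V).
Implicit Types (S : {set V}) (u v w s : seq V) (c x y z : V).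

Local Notation "u ≡ v" := (congruence_closure (hk_rel Q) u v) (at level 70).

Definition word_over S w : bool := all [in S] w.

Lemma word_over_cat S u v : word_over S (u ++ v) = word_over S u && word_over S v.
Proof. exact: all_cat. Qed.

Lemma word_over_rcons S w x : word_over S (rcons w x) = (x \in S) && word_over S w.
Proof. exact: all_rcons. Qed.

Definition finitely_represented S : Prop :=
  exists2 L : seq (seq V), all (word_over S) L
    & forall w, word_over S w -> exists2 v, v \in L & w ≡ v.

Lemma finitely_represented_setT :
  finitely_represented [set: V] -> finite_type Q.
Proof.
case=> L _ HL; rewrite /finite_type.
apply: (@sub_finite_set _ _ (presented_pi (hk_rel Q) @` [set` L])%classic).
  move=> m _; rewrite -(presented_pi_repr m).
  have [|v vL wv] := HL (repr m).
    by apply/allP => x _; rewrite inE.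
  by exists v => //; apply/presented_piP/cc_sym.
exact/finite_image/finite_seq.
Qed.

Lemma cong_catl u v w : v ≡ w -> u ++ v ≡ u ++ w.
Proof. exact: congruence_closure_cat (cc_refl _ _). Qed.

Lemma cong_catr w u v : u ≡ v -> u ++ w ≡ v ++ w.
Proof. by move/congruence_closure_cat; apply; exact: cc_refl. Qed.

Lemma cong_rel u v : hk_rel Q u v -> u ≡ v.
Proof. by move/(cc_rel [::] [::]); rewrite /= !cats0. Qed.

Lemma finitely_represented0 : finitely_represented set0.
Proof.
exists [:: [::]] => // -[|x w]; last by rewrite /= inE.
by move=> _; exists [::]; [rewrite inE | exact: cc_refl].
Qed.

Lemma finitely_represented_suffix S S' (T : seq (seq V)) :
  S' \subset S -> finitely_represented S' ->
  all (word_over S) T -> [::] \in T ->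
  (forall s x, s \in T -> x \in S ->
    exists u s', [/\ word_over S' u, s' \in T & rcons s x ≡ u ++ s']) ->
  finitely_represented S.
Proof.
move=> /fintype.subsetP subS [L LS HL] TS T0 step.
have over_sub u : word_over S' u -> word_over S u.
  by move=> /allP uS'; apply/allP => x /uS'; exact: subS.
have split_word w : word_over S w ->
    exists u s, [/\ word_over S' u, s \in T & w ≡ u ++ s].
  elim/last_ind: w => [_|w x IH].
    by exists [::], [::]; split=> //; exact: cc_refl.
  rewrite word_over_rcons => /andP[xS /IH[u [s [uS' sT wus]]]].
  have [u' [s' [u'S' s'T sx]]] := step s x sT xS.
  exists (u ++ u'), s'; split=> //; first by rewrite word_over_cat uS'.
  rewrite -cats1 -catA; apply: cc_trans (cong_catr [:: x] wus) _.
  by rewrite -catA; apply: cong_catl; rewrite cats1.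
exists [seq v ++ s | v <- L, s <- T].
  apply/allP => _ /allpairsP[[v s] /= [vL sT ->]].
  by rewrite word_over_cat (over_sub _ (allP LS v vL)) (allP TS).
move=> w /split_word[u [s [uS' sT wus]]].
have [v vL uv] := HL u uS'.
exists (v ++ s); first exact: allpairs_f.
exact: cc_trans wus (cong_catr s uv).
Qed.

Definition source S c : bool :=
  [forall j in S, ~~ edge Q c j && ~~ arrow Q j c].

Definition sink S c : bool :=
  [forall j in S, ~~ edge Q c j && ~~ arrow Q c j].

Lemma source_absorb S c w :
  source S c -> word_over S w -> c :: rcons w c ≡ c :: w.
Proof.
move=> /'forall_implyP srcS; elim/last_ind: w => [_|w x IH].
  exact/cong_rel/hk_idem.
rewrite word_over_rcons => /andP[xS wS].
have cxc : [:: c; x; c] ≡ [:: c; x].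
  have /andP[Ncx Nxc] := srcS x xS.
  case cx: (arrow Q c x); first exact/cc_sym/cong_rel/hk_arrow1.
  apply: cc_trans (cong_catl [:: c] (_ : [:: x; c] ≡ [:: c; x])) _.
    apply/cong_rel/hk_comm.
    by rewrite /connected edge_sym (negbTE Ncx) (negbTE Nxc) cx.
  exact: (cong_catr [:: x] (cong_rel (hk_idem Q c))).
have insert t : c :: w ++ t ≡ c :: w ++ c :: t.
  by have := cong_catr t (cc_sym (IH wS)); rewrite /= cat_rcons.
rewrite -!cats1 -catA; apply: cc_trans (insert [:: x; c]) _.
exact: cc_trans (cong_catl (c :: w) cxc) (cc_sym (insert [:: x])).
Qed.

Lemma sink_absorb S c w :
  sink S c -> word_over S w -> c :: rcons w c ≡ rcons w c.
Proof.
move=> /'forall_implyP snkS; elim: w => [_|x w IH].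
  exact/cong_rel/hk_idem.
move=> /andP[xS wS].
have cxc : [:: c; x; c] ≡ [:: x; c].
  have /andP[Ncx Ncx'] := snkS x xS.
  case xc: (arrow Q x c).
    apply: cc_trans (cc_sym (cong_rel (hk_arrow2 xc))) _.
    exact/cc_sym/cong_rel/hk_arrow1.
  apply: cc_trans (cong_catr [:: c] (_ : [:: c; x] ≡ [:: x; c])) _.
    by apply/cong_rel/hk_comm; rewrite /connected (negbTE Ncx) (negbTE Ncx') xc.
  exact: (cong_catl [:: x] (cong_rel (hk_idem Q c))).
apply: cc_trans (cong_catl [:: c; x] (cc_sym (IH wS))) _.
exact: cc_trans (cong_catr (rcons w c) cxc) (cong_catl [:: x] (IH wS)).
Qed.

Lemma finitely_represented_setD1 S c :
  c \in S -> source S c || sink S c ->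
  finitely_represented (S :\ c) -> finitely_represented S.
Proof.
move=> cS src_snk finD; have [L LS HL] := finD.
have over_sub u : word_over (S :\ c) u -> word_over S u.
  by move=> /allP uS'; apply/allP => x /uS'; rewrite inE => /andP[].
have LT v w : v \in L -> w ≡ v ->
    exists u s', [/\ word_over (S :\ c) u,
      s' \in [::] :: [seq c :: v | v <- L] & c :: w ≡ u ++ s'].
  move=> vL wv; exists [::], (c :: v); split=> //.
    by rewrite inE map_f ?orbT.
  exact: (cong_catl [:: c] wv).
apply: (@finitely_represented_suffix S (S :\ c)
          ([::] :: [seq c :: v | v <- L])) => //.
- exact: subD1set.
- apply/allP => _ /[!inE]/predU1P[->//|/mapP[v vL ->]].
  by rewrite /word_over /= cS; exact/over_sub/(allP LS).
have [v0 v0L v0E] := HL [::] isT.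
move=> s x /[!inE]/predU1P[->|/mapP[v vL ->]] xS.
  have [->|xc] := eqVneq x c; first exact: LT v0L v0E.
  exists [:: x], [::]; split=> //; last exact: cc_refl.
  by rewrite /word_over /= !inE xc xS.
have vS := allP LS v vL.
have [->|xc] := eqVneq x c; last first.
  have [|v' v'L vv'] := HL (rcons v x); last exact: LT v'L vv'.
  by rewrite word_over_rcons vS /= !inE xc xS.
case/orP: src_snk => [src|snk].
  exists [::], (c :: v); split=> //; first by rewrite inE map_f ?orbT.
  exact: source_absorb src (over_sub v vS).
exists v, (c :: v0); split=> //; first by rewrite inE map_f ?orbT.
apply: cc_trans (sink_absorb snk (over_sub v vS)) _.
by rewrite -cats1; apply: cong_catl; exact: (cong_catl [:: c] v0E).
Qed.

Lemma finitely_represented1 x : finitely_represented [set x].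
Proof.
apply: (@finitely_represented_setD1 _ x); rewrite ?inE //; last first.
  by rewrite finset.setDv; exact: finitely_represented0.
by apply/orP; left; apply/forall_inP => j /set1P->; rewrite edge_irr arrow_irr.
Qed.

Lemma cong_last u x : rcons (rcons u x) x ≡ rcons u x.
Proof.
rewrite -2!cats1 -catA.
exact: (cong_catl u (cong_rel (hk_idem Q x))).
Qed.

Lemma finitely_represented_edge x y :
  edge Q x y -> finitely_represented [set x; y].
Proof.
move=> xy; have yx : edge Q y x by rewrite edge_sym.
apply: (@finitely_represented_suffix _ [set x] [:: [::]; [:: y]; [:: y; x]]).
- exact: finset.subsetUl.
- exact: finitely_represented1.
- by rewrite /word_over /= !inE !eqxx ?orbT.
- by [].
have out s u s' t : word_over [set x] u -> s' \in [:: [::]; [:: y]; [:: y; x]] ->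
    s ≡ t -> t = u ++ s' -> exists u s', [/\ word_over [set x] u,
      s' \in [:: [::]; [:: y]; [:: y; x]] & s ≡ u ++ s'].
  by move=> uS' sT st tE; exists u, s'; rewrite -tE.
move=> s t /[!inE] /or3P[]/eqP-> /orP[]/eqP-> /=.
- by apply: (out _ [:: x] [::]) (cc_refl _ _) _; rewrite /word_over /= ?inE ?eqxx.
- by apply: (out _ [::] [:: y]) (cc_refl _ _) _; rewrite ?inE ?eqxx ?orbT.
- by apply: (out _ [::] [:: y; x]) (cc_refl _ _) _; rewrite ?inE ?eqxx ?orbT.
- by apply: (out _ [::] [:: y]) (cong_last [::] y) _; rewrite ?inE ?eqxx ?orbT.
- by apply: (out _ [::] [:: y; x]) (cong_last [:: y] x) _;
    rewrite ?inE ?eqxx ?orbT.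
- by apply: (out _ [:: x] [:: y; x]) (cong_rel (hk_braid yx)) _;
    rewrite /word_over /= ?inE ?eqxx ?orbT.
Qed.

Lemma finitely_represented_path x y z :
  edge Q x y -> edge Q y z -> ~~ connected Q x z ->
  finitely_represented [set x; y; z].
Proof.
move=> xy yz Nxz; have zy : edge Q z y by rewrite edge_sym.
have yx : edge Q y x by rewrite edge_sym.
have xz : [:: x; z] ≡ [:: z; x] by exact/cong_rel/hk_comm.
pose T := [:: [::]; [:: z]; [:: z; y]; [:: z; y; x]].
apply: (@finitely_represented_suffix _ [set x; y] T).
- exact: finset.subsetUl.
- exact: finitely_represented_edge.
- by rewrite /word_over /= !inE !eqxx ?orbT.
- by [].
have out u s' s t : s ≡ t -> t = u ++ s' -> word_over [set x; y] u -> s' \in T ->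
    exists u s', [/\ word_over [set x; y] u, s' \in T & s ≡ u ++ s'].
  by move=> st tE uS' sT; exists u, s'; rewrite -tE.
have over u : all [in [:: x; y]] u -> word_over [set x; y] u.
  by move=> /allP uxy; apply/allP => t /uxy; rewrite !inE.
move=> s t; rewrite {1}/T !inE => /or4P[]/eqP-> /orP[/orP[]|]/eqP-> /=.
- by apply: (out [:: x] [::]) (cc_refl _ _) _ (over _ _) _;
    rewrite /= ?inE ?eqxx ?orbT.
- by apply: (out [:: y] [::]) (cc_refl _ _) _ (over _ _) _;
    rewrite /= ?inE ?eqxx ?orbT.
- by apply: (out [::] [:: z]) (cc_refl _ _) _ _ _; rewrite ?inE ?eqxx ?orbT.
- by apply: (out [:: x] [:: z]) (cc_sym xz) _ (over _ _) _;
    rewrite /= ?inE ?eqxx ?orbT.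
- by apply: (out [::] [:: z; y]) (cc_refl _ _) _ _ _; rewrite ?inE ?eqxx ?orbT.
- by apply: (out [::] [:: z]) (cong_last [::] z) _ _ _;
    rewrite ?inE ?eqxx ?orbT.
- by apply: (out [::] [:: z; y; x]) (cc_refl _ _) _ _ _;
    rewrite ?inE ?eqxx ?orbT.
- by apply: (out [::] [:: z; y]) (cong_last [:: z] y) _ _ _;
    rewrite ?inE ?eqxx ?orbT.
- by apply: (out [:: y] [:: z; y]) (cong_rel (hk_braid zy)) _ (over _ _) _;
    rewrite /= ?inE ?eqxx ?orbT.
- by apply: (out [::] [:: z; y; x]) (cong_last [:: z; y] x) _ _ _;
    rewrite ?inE ?eqxx ?orbT.
- (* z y x y = z x y x = x z y x *)
  apply: (out [:: x] [:: z; y; x]) _ (erefl _) (over _ _) _;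
    rewrite /= ?inE ?eqxx ?orbT //.
  apply: cc_trans (cong_catl [:: z] (cong_rel (hk_braid yx))) _.
  exact: (cong_catr [:: y; x] (cc_sym xz)).
- (* z y x z = z y z x = y z y x *)
  apply: (out [:: y] [:: z; y; x]) _ (erefl _) (over _ _) _;
    rewrite /= ?inE ?eqxx ?orbT //.
  apply: cc_trans (cong_catl [:: z; y] xz) _.
  exact: (cong_catr [:: x] (cong_rel (hk_braid zy))).
Qed.

Lemma finitely_represented2 x y : finitely_represented [set x; y].
Proof.
have [->|xy] := eqVneq x y.
  by rewrite finset.setUid; exact: finitely_represented1.
case xyE: (edge Q x y); first exact: finitely_represented_edge.
apply: (@finitely_represented_setD1 _ x); rewrite ?inE ?eqxx //; last first.
  rewrite (_ : _ :\ x = [set y]); first exact: finitely_represented1.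
  by rewrite setU1K // inE.
have : ~~ arrow Q y x || ~~ arrow Q x y.
  case xyA: (arrow Q x y); last by rewrite orbT.
  by rewrite (@arrow_asym _ Q x y).
case/orP=> Nxy; apply/orP; [left|right];
  by apply/forall_inP => j /set2P[]->; rewrite ?edge_irr ?arrow_irr ?xyE ?Nxy.
Qed.

Definition linked x y : bool := edge Q x y || arrow Q x y.

Lemma acyclic_triangle x y z : acyclic Q ->
  x != y -> y != z -> x != z -> ~~ [&& linked x y, linked y z & linked z x].
Proof.
move=> acQ xy yz xz; apply/negP => /and3P[lxy lyz lzx].
apply: (acQ 3 (fun i : 'Z_3 => nth x [:: x; y; z] i)); split=> //.
  move=> i j /eqP; rewrite nth_uniq ?ltn_ord //.
    by move=> /eqP/val_inj.
  by rewrite /= !inE negb_or xy xz yz.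
by case=> [[|[|[|]]]].
Qed.

Lemma finitely_represented3 x y z : acyclic Q ->
  finitely_represented [set x; y; z].
Proof.
move=> acQ.
have [->|xy] := eqVneq x y.
  by rewrite finset.setUid; exact: finitely_represented2.
have [->|yz] := eqVneq y z.
  by rewrite -finset.setUA finset.setUid; exact: finitely_represented2.
have [->|xz] := eqVneq x z.
  by rewrite finset.setUAC finset.setUid; exact: finitely_represented2.
pose ends c := source [set x; y; z] c || sink [set x; y; z] c.
have [/hasP[c cS cE]|] := boolP (has ends [:: x; y; z]).
  apply: finitely_represented_setD1 cE _.
    by move: cS; rewrite !inE orbA.
  move: cS; rewrite !inE => /or3P[]/eqP->.
  - rewrite -finset.setUA setU1K; first exact: finitely_represented2.
    by rewrite !inE negb_or xy xz.
  - rewrite (finset.setUC [set x]) -finset.setUA setU1K.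
      exact: finitely_represented2.
    by rewrite !inE negb_or eq_sym xy yz.
  - rewrite finset.setUC setU1K; first exact: finitely_represented2.
    by rewrite !inE negb_or (eq_sym z) xz eq_sym yz.
have endsE c : ends c =
    [&& ~~ edge Q c x && ~~ arrow Q x c, ~~ edge Q c y && ~~ arrow Q y c
      & ~~ edge Q c z && ~~ arrow Q z c] ||
    [&& ~~ edge Q c x && ~~ arrow Q c x, ~~ edge Q c y && ~~ arrow Q c y
      & ~~ edge Q c z && ~~ arrow Q c z].
  by congr orb; (apply/forall_inP/and3P => [H|[Hx Hy Hz] j];
    [split; apply: H; rewrite !inE eqxx ?orbT
    | rewrite !inE => /orP[/orP[]|]/eqP->]).
rewrite /= !endsE !edge_irr !arrow_irr /=.
have pathP : [|| [&& edge Q x y, edge Q y z & ~~ connected Q x z],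
    [&& edge Q y x, edge Q x z & ~~ connected Q y z]
  | [&& edge Q x z, edge Q z y & ~~ connected Q x y]] ->
    finitely_represented [set x; y; z].
  case/or3P=> /and3P[].
  - exact: finitely_represented_path.
  - by rewrite (finset.setUC [set x]); exact: finitely_represented_path.
  - by rewrite finset.setUAC; exact: finitely_represented_path.
move=> noend; apply: pathP; move: noend.
have := acyclic_triangle acQ xy yz xz.
have := acyclic_triangle acQ xz (etrans (congr1 negb (eq_sym z y)) yz) xy.
have := @arrow_asym _ Q x y; have := @arrow_asym _ Q y z.
have := @arrow_asym _ Q x z.
have := @arrow_not_edge _ Q x y; have := @arrow_not_edge _ Q y x.
have := @arrow_not_edge _ Q y z; have := @arrow_not_edge _ Q z y.
have := @arrow_not_edge _ Q x z; have := @arrow_not_edge _ Q z x.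
rewrite /linked /connected !(edge_sym Q y x) !(edge_sym Q z x) !(edge_sym Q z y).
by case: (edge Q x y); case: (edge Q x z); case: (edge Q y z);
  case: (arrow Q x y) => //=; case: (arrow Q y x) => //=;
  case: (arrow Q x z) => //=; case: (arrow Q z x) => //=;
  case: (arrow Q y z) => //=; case: (arrow Q z y) => //=; intuition.
Qed.

Lemma finitely_represented_le3 S :
  acyclic Q -> #|S| <= 3 -> finitely_represented S.
Proof.
move=> acQ; have [->|[x xS]] := set_0Vmem S.
  by move=> _; exact: finitely_represented0.
rewrite (cardsD1 x) xS ltnS => leS; rewrite -(setD1K xS).
have [->|[y yS]] := set_0Vmem (S :\ x).
  by rewrite finset.setU0; exact: finitely_represented1.
move: leS; rewrite (cardsD1 y) yS ltnS => leS; rewrite -(setD1K yS).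
have [->|[z zS]] := set_0Vmem (S :\ x :\ y).
  by rewrite finset.setU0; exact: finitely_represented2.
move: leS; rewrite (cardsD1 z) zS ltnS leqn0 cards_eq0 => /eqP S0.
rewrite -(setD1K zS) S0 finset.setU0 finset.setUA.
exact: finitely_represented3.
Qed.

End Words.

Theorem theorem3p1 (V : finType) (Q : digraph V) :
  #|V| <= 3 -> acyclic Q -> finite_type Q.
Proof.
move=> leV acQ; apply: finitely_represented_setT.
by apply: finitely_represented_le3; rewrite ?cardsT.
Qed.
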